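(* Let $G=(\mathcal{N},\mathcal{L})$ be a finite connected simple graph and let $r>0$. Let $\mathbf{x}^\star$ be a mixed stationary state, with a single consensus link, of the system $\frac{dx_k}{dt}=\sum_{l\sim k}\left[r(x_k-x_l)-(x_k-x_l)^3\right]$ on $G$; that is, $\mathcal{L}_{=}=\{(i,j)\}$ for one link $i\sim j$, and all other links are dissensus links. Let $\omega_{ij}$ be the effective resistance between $i$ and $j$ in $G$. Then: if $\omega_{ij}<2/3$, $\mathbf{x}^\star$ is stable; if $\omega_{ij}>2/3$, $\mathbf{x}^\star$ is unstable.
   Context: $G=(\mathcal{N},\mathcal{L})$ is an undirected graph with $N$ nodes, without self-loops or multiple links; $i\sim j$ means that $i$ and $j$ are linked. The system is $\frac{dx_i}{dt}=\sum_{j\sim i}\left[r(x_i-x_j)-(x_i-x_j)^3\right]$ for all nodes $i$, with system parameter $r\in\mathbb{R}$. The state space is $X=\mathbb{R}^N/\mathbf{1}$: two states are identified if they differ by a constant vector. A stationary state is a state $\mathbf{x}^\star$ at which all right-hand sides vanish. A detailed-balance stationary state is a state $\mathbf{x}^\star$ with $x_i^\star-x_j^\star\in\{0,\pm\sqrt r\}$ for all $i\sim j$. Such states are stationary. A link with difference $0$ is a consensus link, and a link with difference $\pm\sqrt r$ is a dissensus link; $\mathcal{L}_{=}$ denotes the set of consensus links of $\mathbf{x}^\star$. A mixed stationary state is a detailed-balance stationary state having both consensus and dissensus links. Stability is meant in the linear sense. Let $J(\mathbf{x}^\star)$ be the (symmetric) $N\times N$ Jacobian matrix of the right-hand side at $\mathbf{x}^\star$;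 the constant vector is always in its kernel. The state $\mathbf{x}^\star$ is stable if $J(\mathbf{x}^\star)$ is negative definite on the orthogonal complement of the constant vector, and unstable if $J(\mathbf{x}^\star)$ has at least one positive eigenvalue. The Laplacian $Q$ of $G$ has entries $Q_{ii}=d_i$ (the degree of $i$), $Q_{ij}=-1$ if $i\sim j$, and $0$ otherwise. The effective resistance is $\omega_{ij}=(\mathbf{e}_i-\mathbf{e}_j)^TQ^\dagger(\mathbf{e}_i-\mathbf{e}_j)$, with $Q^\dagger$ the Moore–Penrose pseudoinverse of $Q$ and $\mathbf{e}_i$ the standard unit vectors. *)

(* Defs.v *)
From mathcomp Require Import all_boot all_order all_algebra.
From mathcomp Require Import all_classical all_reals all_analysis.

Set Implicit Arguments.
Unset Strict Implicit.
Unset Printing Implicit Defensive.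

Import Order.TTheory GRing.Theory Num.Theory numFieldNormedType.Exports.

Local Open Scope ring_scope.

(* A simple graph on 'I_N is a symmetric irreflexive e : rel 'I_N.  A state is
   given by a representative x : 'rV[R]_N of its class modulo constant vectors;
   every notion below is invariant under adding a constant vector to x. *)

Section Graph.
Context {N : nat}.
Implicit Type e : rel 'I_N.

Definition connected_graph e := forall k l : 'I_N, connect e k l.

Definition links_where e (P : rel 'I_N) : {set {set 'I_N}} :=
  [set [set p.1; p.2] | p : 'I_N * 'I_N & e p.1 p.2 && P p.1 p.2]%SET.

End Graph.

Section PseudoInverse.
Context {R : realType}.

Definition penrose m n (A : 'M[R]_(m, n)) (B : 'M[R]_(n, m)) : Prop :=
  [/\ A *m B *m A = A, B *m A *m B = B,
      (A *m B)^T = A *m B & (B *m A)^T = B *m A].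

Lemma penrose_unique m n (A : 'M[R]_(m, n)) (B C : 'M[R]_(n, m)) :
  penrose A B -> penrose A C -> B = C.
Proof.
move=> [ABA BAB ABt BAt] [ACA CAC ACt CAt].
have BA_CA : B *m A = C *m A.
  rewrite -[LHS]BAt -{1}ACA -[A *m C *m A]mulmxA mulmxA trmx_mul CAt BAt.
  by rewrite -mulmxA (mulmxA A) ABA.
have AB_AC : A *m B = A *m C.
  rewrite -[LHS]ABt -{1}ACA -[A *m C *m A *m B]mulmxA trmx_mul ABt ACt.
  by rewrite mulmxA ABA.
by rewrite -BAB BA_CA -mulmxA AB_AC mulmxA.
Qed.

Lemma gram_unit m n (A : 'M[R]_(m, n)) :
  row_free A -> A *m A^T \in unitmx.
Proof.
move=> freeA; rewrite -row_free_unit; apply: inj_row_free => v vAA.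
apply/eqP; rewrite -(mulmx_free_eq0 v freeA); apply/eqP/rowP => j.
have : ((v *m A) *m (v *m A)^T) 0 0 = 0.
  by rewrite trmx_mul mulmxA -(mulmxA v) vAA mul0mx mxE.
have sqE k : (v *m A) 0 k * (v *m A)^T k 0 = (v *m A) 0 k ^+ 2.
  by rewrite [X in _ * X]mxE expr2.
rewrite mxE (eq_bigr _ (fun k _ => sqE k)) => /psumr_eq0P sq0.
apply/eqP; rewrite [in eqbRHS]mxE -sqrf_eq0; apply/eqP; apply: sq0 => // k _.
exact: sqr_ge0.
Qed.

Lemma penrose_exists m n (A : 'M[R]_(m, n)) : exists B, penrose A B.
Proof.
have [q [C [D [AE fullC freeD]]]] :
    exists q (C : 'M[R]_(m, q)) (D : 'M[R]_(q, n)),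
    [/\ A = C *m D, row_full C & row_free D].
  exists (\rank A), (col_base A), (row_base A).
  by split; [rewrite mulmx_base | exact: col_base_full | exact: row_base_free].
have uD : D *m D^T \in unitmx by exact: gram_unit.
have uC : C^T *m C \in unitmx.
  by rewrite -{2}(trmxK C); apply: gram_unit; rewrite /row_free mxrank_tr.
pose D' := D^T *m invmx (D *m D^T); pose C' := invmx (C^T *m C) *m C^T.
have DD' : D *m D' = 1%:M by rewrite mulmxA mulmxV.
have C'C : C' *m C = 1%:M by rewrite -mulmxA mulVmx.
have CC't : (C *m C')^T = C *m C'.
  by rewrite /C' !trmx_mul trmx_inv trmx_mul !trmxK mulmxA.
have D'Dt : (D' *m D)^T = D' *m D.
  by rewrite /D' !trmx_mul trmx_inv trmx_mul !trmxK mulmxA.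
have AB : A *m (D' *m C') = C *m C'.
  by rewrite AE -mulmxA (mulmxA D) DD' mul1mx.
have BA : D' *m C' *m A = D' *m D.
  by rewrite AE -mulmxA (mulmxA C') C'C mul1mx.
exists (D' *m C'); split; rewrite ?AB ?BA //.
  by rewrite AE -mulmxA (mulmxA C') C'C mul1mx.
by rewrite -mulmxA (mulmxA D) DD' mul1mx.
Qed.

Definition mppinv m n (A : 'M[R]_(m, n)) : 'M[R]_(n, m) := xget 0 (penrose A).

Lemma mppinvP m n (A : 'M[R]_(m, n)) : penrose A (mppinv A).
Proof. exact: (@xgetPex _ 0 (penrose A) (penrose_exists A)). Qed.

End PseudoInverse.

Section EffectiveResistance.
Context {R : realType} {N : nat}.

Definition laplacian (e : rel 'I_N) : 'M[R]_N :=
  \matrix_(k, l) if k == l then #|[set m | e k m]%SET|%:R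
                 else if e k l then -1 else 0.

Definition effective_resistance (e : rel 'I_N) (i j : 'I_N) : R :=
  let u : 'cV[R]_N := delta_mx i 0 - delta_mx j 0 in
  (u^T *m mppinv (laplacian e) *m u) 0 0.

End EffectiveResistance.

Section Dynamics.
Context {R : realType} {N : nat}.
Implicit Types (e : rel 'I_N) (r : R) (x : 'rV[R]_N).

Definition rhs e r x : 'rV[R]_N :=
  \row_k \sum_(l | e k l) (r * (x 0 k - x 0 l) - (x 0 k - x 0 l) ^+ 3).

Definition stationary e r x := rhs e r x = 0.

Definition detailed_balance e r x :=
  forall k l, e k l -> x 0 k - x 0 l \in [:: 0; Num.sqrt r; - Num.sqrt r].

Lemma detailed_balance_stationary e r x :
  0 <= r -> detailed_balance e r x -> stationary e r x.
Proof.
move=> r0 db; apply/rowP => k; rewrite !mxE big1 // => l /db.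
rewrite !inE => /or3P[] /eqP->; first by rewrite mulr0 expr0n subr0.
  by rewrite exprSr sqr_sqrtr // subrr.
by rewrite exprSr sqrrN sqr_sqrtr // subrr.
Qed.

Definition consensus_links e x :=
  links_where e (fun k l => x 0 k - x 0 l == 0).

Definition dissensus_links e r x :=
  links_where e (fun k l => x 0 k - x 0 l \in [:: Num.sqrt r; - Num.sqrt r]).

Definition mixed_stationary e r x :=
  [/\ detailed_balance e r x, consensus_links e x != finset.set0
    & dissensus_links e r x != finset.set0].

(* [jacobian] acts on row vectors by right multiplication; the transpose has
   entry (k, l) equal to the derivative of component k of [rhs] in x_l. *)
Definition Jac e r x : 'M[R]_N := (jacobian (rhs e r) x)^T.

Definition stable e r x :=
  forall v : 'cV[R]_N, (const_mx 1)^T *m v = 0 :> 'M[R]_1 -> v != 0 ->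
    (v^T *m Jac e r x *m v) 0 0 < 0.

Definition unstable e r x :=
  exists a : R, eigenvalue (Jac e r x) a /\ 0 < a.

End Dynamics.

(* Main.v *)
Require Import Defs.
From HB Require Import structures.
From mathcomp Require Import all_boot all_order all_algebra reals.
From mathcomp Require Import all_classical all_analysis ring lra.

Local Open Scope ring_scope.

(** Write [Q] for the Laplacian, [d = e_i - e_j] for the dipole across the only
    consensus link, and [omega] for the effective resistance between [i] and
    [j].  The flux function [t |-> r * t - t ^+ 3] has derivative [r] at [0]
    and [- 2 * r] at the two points where [t ^+ 2 = r].  All links therefore
    enter the Jacobian with weight [- 2 * r], except [i -- j], whose weight
    exceeds that by [3 * r]; so (lemma [Jac_decomposition])
<<
      Jac = - 2 r Q + 3 r d d^T.
>>
    Let [w] be the potential created by the dipole, that is [w = Q^+ d] with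
    [Q^+] the pseudoinverse.  As the graph is connected, [Q] is positive
    semidefinite with only the constants in its kernel, so [Q w = d].  In
    terms of the form of [Q] this says that [<w, v>_Q = v_i - v_j] for all [v]
    and that [<w, w>_Q = omega].

    - Stability: Cauchy-Schwarz for [<., .>_Q] gives
      [(v_i - v_j)^2 <= omega <v, v>_Q], so the form of the Jacobian at [v] is
      at most [r (3 omega - 2) <v, v>_Q], which is negative when
      [omega < 2 / 3] and [v] is a nonzero vector orthogonal to the constants.
    - Instability: at [v = w] the form of the Jacobian equals
      [r omega (3 omega - 2)], positive when [omega > 2 / 3].  A symmetric
      matrix whose form is positive somewhere has a positive eigenvalue, namely
      the maximum of its Rayleigh quotient ([mxform_pos_eigenvalue]). *)

Set Implicit Arguments.
Unset Strict Implicit.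
Unset Printing Implicit Defensive.

Import Order.TTheory GRing.Theory Num.Theory numFieldNormedType.Exports.

(** * Positive semidefinite forms *)

Section Form.
Context {R : realFieldType} {n : nat}.
Implicit Types (A : 'M[R]_n) (u v w : 'rV[R]_n).

Definition mxform A v w : R := (v *m A *m w^T) 0 0.

Lemma mxformDl A u v w : mxform A (u + v) w = mxform A u w + mxform A v w.
Proof. by rewrite /mxform !mulmxDl mxE. Qed.

Lemma mxformZl A a v w : mxform A (a *: v) w = a * mxform A v w.
Proof. by rewrite /mxform -!scalemxAl mxE. Qed.

Lemma mxformDr A u v w : mxform A w (u + v) = mxform A w u + mxform A w v.
Proof. by rewrite /mxform linearD mulmxDr mxE. Qed.

Lemma mxformZr A a v w : mxform A v (a *: w) = a * mxform A v w.
Proof. by rewrite /mxform linearZ /= -scalemxAr mxE. Qed.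

Lemma mxformC A v w : A^T = A -> mxform A v w = mxform A w v.
Proof.
move=> At; rewrite /mxform -[in LHS](trmxK (_ *m _)) mxE.
by rewrite !trmx_mul trmxK At mulmxA.
Qed.

Lemma mxformE A v w : mxform A v w = \sum_k v 0 k * (w *m A^T) 0 k.
Proof.
rewrite /mxform -mulmxA mxE; apply: eq_bigr => k _.
by rewrite -[_ *m A^T]trmxK trmx_mul trmxK [in RHS]mxE.
Qed.

Lemma mxform1E v w : mxform 1%:M v w = \sum_k v 0 k * w 0 k.
Proof. by rewrite mxformE trmx1 mulmx1. Qed.

Lemma mxform1_ge0 v : 0 <= mxform 1%:M v v.
Proof. by rewrite mxform1E sumr_ge0 // => k _; rewrite -expr2 sqr_ge0. Qed.

Lemma mxform1_eq0 v : (mxform 1%:M v v == 0) = (v == 0).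
Proof.
apply/eqP/eqP => [|->]; last by rewrite /mxform !mul0mx mxE.
rewrite mxform1E => /psumr_eq0P v0; apply/rowP => k; rewrite mxE.
by apply/eqP; rewrite -sqrf_eq0 expr2 v0 // => l _; rewrite -expr2 sqr_ge0.
Qed.

Definition psd A := forall v, 0 <= mxform A v v.

Lemma psd_cauchy_schwarz A v w : A^T = A -> psd A ->
  mxform A v w ^+ 2 <= mxform A v v * mxform A w w.
Proof.
move=> At A_ge0.
have q s t : 0 <= s ^+ 2 * mxform A v v + 2 * (s * t) * mxform A v w
               + t ^+ 2 * mxform A w w.
  have := A_ge0 (s *: v + t *: w).
  rewrite !(mxformDl, mxformDr, mxformZl, mxformZr) (mxformC w v At).
  by congr (0 <= _); ring.
move: (A_ge0 v) (A_ge0 w) q.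
move: (mxform A v v) (mxform A w w) (mxform A v w) => a c b a0 c0 q.
(* The first two choices of (s, t) give c * (a * c - b ^ 2) and
   a * (a * c - b ^ 2); the third one settles the case a = c = 0. *)
have := q c (- b); have := q (- b) a; have := q 1 (- b).
case: (ltP 0 c) => [cp|cn]; first by nra.
by case: (ltP 0 a) => [ap|an]; nra.
Qed.

(** By Cauchy-Schwarz an isotropic vector of a positive semidefinite form is
    orthogonal to every vector, in particular to its own image. *)
Lemma psd_isotropic A v : A^T = A -> psd A -> mxform A v v = 0 -> v *m A = 0.
Proof.
move=> At A_ge0 v0; have := psd_cauchy_schwarz v (v *m A) At A_ge0.
rewrite v0 mul0r.
have -> : mxform A v (v *m A) = mxform 1%:M (v *m A) (v *m A).
  by rewrite /mxform mulmx1.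
by move=> h; apply/eqP; rewrite -mxform1_eq0 -sqrf_eq0 eq_le h sqr_ge0.
Qed.

End Form.

(** * Rayleigh quotients and positive eigenvalues *)

Lemma sum_continuous (K : numFieldType) (V : normedModType K)
    (T : topologicalType) (I : Type) (s : seq I) (P : pred I) (f : I -> T -> V) :
  (forall i, P i -> continuous (f i)) ->
  continuous (\sum_(i <- s | P i) f i).
Proof.
move=> cf; apply: (big_ind (fun g : T -> V => continuous g)) => //.
  by move=> x; apply: cst_continuous.
by move=> g h cg ch x; apply: continuousD; [apply: cg|apply: ch].
Qed.

Section Rayleigh.
Context {R : realType} {n : nat}.
Implicit Types (A : 'M[R]_n) (v w : 'rV[R]_n).

Lemma mxform_continuous A : continuous (fun v => mxform A v v).
Proof.
have -> : (fun v => mxform A v v) =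
    \sum_k \sum_l fun v : 'rV[R]_n => A k l * (v 0 k * v 0 l).
  apply/funext => v; rewrite mxformE fct_sumE; apply: eq_bigr => k _.
  rewrite fct_sumE mxE big_distrr; apply: eq_bigr => l _ /=.
  by rewrite mxE; ring.
apply: sum_continuous => k _; apply: sum_continuous => l _ v.
have ck := @coord_continuous R 1 n 0 k v.
have cl := @coord_continuous R 1 n 0 l v.
exact: (cvgMl_tmp (cvgM ck cl)).
Qed.

(** The form attains its maximum on the compact unit sphere; homogeneity turns
    this into a bound on all vectors.  The vector [v0] witnesses that the
    sphere is not empty. *)
Lemma rayleigh_max v0 A : v0 != 0 ->
  exists2 c, mxform 1%:M c c = 1 &
    forall w, mxform A w w <= mxform A c c * mxform 1%:M w w.
Proof.
move=> v0_neq0.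
have normalize w : w != 0 -> exists2 a, mxform 1%:M w w = a ^+ 2 &
    mxform 1%:M (a^-1 *: w) (a^-1 *: w) = 1.
  move=> w0; exists (Num.sqrt (mxform 1%:M w w)).
    by rewrite sqr_sqrtr // mxform1_ge0.
  rewrite mxformZl mxformZr mulrA -expr2 exprVn sqr_sqrtr ?mxform1_ge0 //.
  by rewrite mulVf // mxform1_eq0.
pose S := [set v : 'rV[R]_n | mxform 1%:M v v = 1]%classic.
have S0 : (S !=set0)%classic.
  by have [a _ Sv] := normalize _ v0_neq0; exists (a^-1 *: v0).
have S_compact : compact S.
  apply: bounded_closed_compact; last first.
    apply: (@closed_comp _ _ (fun v => mxform 1%:M v v)
              [set a | a = 1]%classic) => [v _|].
      exact: mxform_continuous.
    exact: closed_eq.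
  (* The norm of row vectors is the maximum of the coordinates, each of which
     has its square bounded by the sum of squares. *)
  exists 1; split => // M M1 v Sv; apply: le_trans (ltW M1).
  rewrite [leLHS]/Num.Def.normr/= mx_normrE (bigmax_le _ ler01) //=.
  move=> -[z k] _ /=.
  rewrite (ord1 z) -(@ler_pXn2r _ 2) ?nnegrE //.
  rewrite expr1n real_normK ?num_real // -Sv mxform1E (bigD1 k) //=.
  rewrite -expr2 lerDl.
  by rewrite sumr_ge0 // => l _; rewrite -expr2 sqr_ge0.
have [c /set_mem Sc maxc] := EVT_max_rV S0 S_compact
   (continuous_subspaceT (@mxform_continuous A)).
exists c => // w; have [->|w0] := eqVneq w 0.
  by rewrite /mxform !mul0mx mxE mulr0.
have [a wa Sw] := normalize w w0.
have a0 : a != 0 by rewrite -sqrf_eq0 -wa mxform1_eq0.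
have := maxc _ (mem_set Sw); rewrite mxformZl mxformZr wa => h.
rewrite -ler_pdivrMr ?exprn_even_gt0 //; apply: le_trans h.
by rewrite le_eqVlt; apply/orP; left; apply/eqP; field.
Qed.

(** With [m] the maximum of the Rayleigh quotient and [c] a maximizer,
    [m%:M - A] is positive semidefinite and [c] is isotropic for it, hence in
    its kernel. *)
Lemma mxform_pos_eigenvalue A v : A^T = A -> 0 < mxform A v v ->
  exists a, eigenvalue A a /\ 0 < a.
Proof.
move=> At v_gt0.
have v0 : v != 0.
  by apply: contraTneq v_gt0 => ->; rewrite /mxform !mul0mx mxE ltxx.
have [c c1 maxc] := rayleigh_max A v0.
set m := mxform A c c in maxc; exists m.
pose B := m%:M - A.
have BE w : mxform B w w = m * mxform 1%:M w w - mxform A w w.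
  rewrite /mxform mulmxBr mulmxBl mul_mx_scalar mulmx1 -scalemxAl.
  by rewrite 3!mxE [in LHS]mxE.
have Bt : B^T = B by rewrite /B linearB /= tr_scalar_mx At.
have cB : c *m B = 0.
  apply: psd_isotropic => //; last by rewrite BE c1 mulr1 subrr.
  by move=> w; rewrite BE subr_ge0.
split; last first.
  have := lt_le_trans v_gt0 (maxc v).
  by rewrite pmulr_lgt0 // lt_def mxform1_eq0 v0 mxform1_ge0.
apply/eigenvalueP; exists c; last first.
  by rewrite -mxform1_eq0 c1 oner_eq0.
by apply/eqP; rewrite eq_sym -subr_eq0 -mul_mx_scalar -mulmxBr cB.
Qed.

End Rayleigh.

(** * Differential of the vector field *)

Lemma is_diff_sum (R : numFieldType) (V W : normedModType R) (I : Type)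
    (s : seq I) (P : pred I) (f df : I -> V -> W) (x : V) :
  (forall i, P i -> is_diff x (f i) (df i)) ->
  is_diff x (\sum_(i <- s | P i) f i) (\sum_(i <- s | P i) df i).
Proof.
move=> fP; elim/big_rec2: _ => [|i g dg Pi]; first exact: is_diff_cst.
exact: is_diffD (fP i Pi).
Qed.

Section Jacobian.
Context {R : realType} {N : nat}.
Implicit Types (e : rel 'I_N) (x h : 'rV[R]_N) (r : R).

Lemma is_diff_link_flux r x (k l : 'I_N) :
  is_diff x
    (fun y : 'rV[R]_N => (r * (y 0 k - y 0 l) - (y 0 k - y 0 l) ^+ 3) : R)
    (fun h => (r - 3 * (x 0 k - x 0 l) ^+ 2) * (h 0 k - h 0 l)).
Proof.
pose p i := fun y : 'rV[R]_N => y 0 i : R.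
have p_diff i : is_diff x (p i) (p i).
  have p_lin : linear (p i) by move=> a y z; rewrite /p !mxE.
  pose pL : {linear 'rV[R]_N -> R} :=
    HB.pack (p i) (GRing.isLinear.Build _ _ _ _ _ p_lin).
  have p_cont : continuous pL by exact: coord_continuous.
  rewrite (_ : p i = pL) //; apply: DiffDef; last by rewrite diff_lin.
  exact/linear_differentiable.
rewrite (_ : (fun y => _) = r *: (p k - p l) - (p k - p l) ^+ 3); last first.
  by apply/funext => y; rewrite !fctE.
apply: is_diff_eq; apply/funext => h.
by rewrite !fctE /p /= /GRing.scale /=; ring.
Qed.

(** The rows are decomposed on the standard basis, so that differentiability of
    the vector field follows from that of the fluxes. *)
Lemma is_diff_rhs e r x :
  is_diff x (rhs e r)
    (fun h => \row_k \sum_(l | e k l)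
       (r - 3 * (x 0 k - x 0 l) ^+ 2) * (h 0 k - h 0 l)).
Proof.
pose G (F : 'I_N -> 'I_N -> 'rV[R]_N -> R) : 'rV[R]_N -> 'rV[R]_N :=
  \sum_k (fun y => (\sum_(l | e k l) F k l) y *: delta_mx 0 k).
have GE F : (fun y : 'rV[R]_N => \row_k \sum_(l | e k l) F k l y) = G F.
  apply/funext => y; rewrite /G fct_sumE [LHS]row_sum_delta.
  by apply: eq_bigr => k _; rewrite mxE fct_sumE.
suff : is_diff x
    (G (fun k l y => r * (y 0 k - y 0 l) - (y 0 k - y 0 l) ^+ 3))
    (G (fun k l h => (r - 3 * (x 0 k - x 0 l) ^+ 2) * (h 0 k - h 0 l))).
  by rewrite -!GE.
apply: is_diff_sum => k _.
have dF := @is_diff_sum _ _ _ _ (index_enum _) (e k) _ _ x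
  (fun l _ => is_diff_link_flux r x k l).
exact: (@is_diff_comp _ _ _ _ _ _ _ _ x dF
         (is_diff_scalel _ (delta_mx 0 k : 'rV[R]_N))).
Qed.

Lemma mul_Jac_tr e r x h :
  h *m (Jac e r x)^T =
  \row_k \sum_(l | e k l) (r - 3 * (x 0 k - x 0 l) ^+ 2) * (h 0 k - h 0 l).
Proof.
rewrite /Jac trmxK /jacobian mul_rV_lin1.
by rewrite (@diff_val _ _ _ _ _ _ _ (is_diff_rhs e r x)).
Qed.

End Jacobian.

(** * Laplacian, dipoles and effective resistance *)

Section Laplacian.
Context {R : realType} {N : nat}.
Variables (e : rel 'I_N).
Hypotheses (e_sym : symmetric e) (e_irr : irreflexive e).
Implicit Types (v : 'rV[R]_N) (i j k l : 'I_N).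
Notation Q := (laplacian e : 'M[R]_N).

Lemma laplacian_tr : Q^T = Q.
Proof.
by apply/matrixP => k l; rewrite !mxE e_sym eq_sym; case: eqP => // ->.
Qed.

Lemma mul_laplacian v : v *m Q = \row_k \sum_(l | e k l) (v 0 k - v 0 l).
Proof.
apply/rowP => k; rewrite !mxE (bigD1 k) //= mxE eqxx sumrB sumr_const.
rewrite cardsE mulr_natr; congr (_ + _).
rewrite -sumrN big_mkcond [RHS]big_mkcond; apply: eq_bigr => l _ /=.
rewrite mxE; have [->|lk] := eqVneq l k; first by rewrite e_irr.
by rewrite e_sym; case: ifP; rewrite ?mulr0 ?mulrN1.
Qed.

Lemma laplacian_const : Q *m const_mx 1 = 0 :> 'cV[R]_N.
Proof.
apply: trmx_inj; rewrite trmx_mul laplacian_tr trmx_const mul_laplacian trmx0.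
by apply/rowP => k; rewrite !mxE big1 // => l _; rewrite !mxE subrr.
Qed.

(** Every link is counted twice, once from each end, hence the factor 2. *)
Lemma laplacian_form v :
  mxform Q v v *+ 2 = \sum_k \sum_(l | e k l) (v 0 k - v 0 l) ^+ 2.
Proof.
have swap_ends :
    mxform Q v v = \sum_k \sum_(l | e k l) v 0 l * (v 0 l - v 0 k).
  rewrite mxformE laplacian_tr mul_laplacian.
  under eq_bigr => k _ do rewrite mxE big_distrr /= big_mkcond.
  rewrite exchange_big; apply: eq_bigr => k _ /=; rewrite [RHS]big_mkcond.
  by apply: eq_bigr => l _; rewrite e_sym.
rewrite mulr2n {1}swap_ends mxformE laplacian_tr mul_laplacian -big_split.
apply: eq_bigr => k _ /=; rewrite mxE big_distrr -big_split.
by apply: eq_bigr => l _ /=; ring.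
Qed.

Lemma laplacian_psd : psd Q.
Proof.
move=> v; rewrite -(pmulrn_lge0 _ (ltn0Sn 1)) laplacian_form.
by apply: sumr_ge0 => k _; apply: sumr_ge0 => l _; rewrite sqr_ge0.
Qed.

Definition dipole i j : 'rV[R]_N := delta_mx 0 i - delta_mx 0 j.

Lemma dipole_tr i j : (dipole i j)^T = delta_mx i 0 - delta_mx j 0.
Proof. by rewrite /dipole linearB /= !trmx_delta. Qed.

Lemma mul_dipole_tr i j v : v *m (dipole i j)^T = (v 0 i - v 0 j)%:M.
Proof. by rewrite [LHS]mx11_scalar dipole_tr mulmxBr -!colE !mxE. Qed.

(** The rows are to be read as transposed columns: this is [Q^+ (e_i - e_j)]. *)
Definition potential i j : 'rV[R]_N := dipole i j *m (mppinv Q)^T.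

Hypothesis (e_conn : connected_graph e).

Lemma laplacian_ker v k l : mxform Q v v = 0 -> v 0 k = v 0 l.
Proof.
move=> v0.
have edge a b : e a b -> v 0 a = v 0 b.
  have := laplacian_form v; rewrite v0 mul0rn => /esym /psumr_eq0P s0 ab.
  have {}s0 := s0 (fun i _ => sumr_ge0 _ (fun j _ => sqr_ge0 _)) a isT.
  have /psumr_eq0P s1 := s0; have := s1 (fun i _ => sqr_ge0 _) b ab.
  by move/eqP; rewrite sqrf_eq0 subr_eq0 => /eqP.
have /connectP [p] := e_conn k l.
elim: p k => [k _ ->//|a p IH k] /= /andP [/edge -> pp] lp; exact: IH lp.
Qed.

Lemma laplacian_ker_orth v :
  mxform Q v v = 0 -> v *m const_mx 1 = 0 :> 'M[R]_1 -> v = 0.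
Proof.
move=> v0 v_orth; apply/rowP => k; rewrite mxE; apply/eqP.
have : (v *m const_mx 1 : 'M[R]_1) 0 0 = v 0 k *+ N.
  rewrite mxE (eq_bigr (fun=> v 0 k)) ?sumr_const ?card_ord // => l _.
  by rewrite mxE mulr1; apply: laplacian_ker.
rewrite v_orth mxE => /esym/eqP; rewrite mulrn_eq0 => /orP [/eqP N0|//].
by have := ltn_ord k; rewrite [X in (_ < X)%N]N0.
Qed.

(** Since [Q Q^+ Q = Q] and [Q Q^+] is symmetric, the difference of both sides is
    in the kernel of [Q]; it is also orthogonal to the constants, as dipoles
    and the image of [Q] are. *)
Lemma potential_laplacian i j : potential i j *m Q = dipole i j.
Proof.
have [QPQ _ Pt _] := mppinvP Q; set P := mppinv Q in QPQ Pt *.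
have wQ : potential i j *m Q = dipole i j *m (Q *m P).
  by rewrite /potential -mulmxA -Pt trmx_mul laplacian_tr.
apply/eqP; rewrite -subr_eq0; apply/eqP/laplacian_ker_orth.
  by rewrite /mxform wQ mulmxBl -mulmxA QPQ subrr mul0mx mxE.
rewrite mulmxBl -mulmxA laplacian_const mulmx0 sub0r /dipole mulmxBl.
by rewrite -!rowE !row_const subrr oppr0.
Qed.

Lemma mxform_potential i j v : mxform Q (potential i j) v = v 0 i - v 0 j.
Proof.
rewrite /mxform potential_laplacian -[dipole i j]trmxK -trmx_mul.
by rewrite mul_dipole_tr tr_scalar_mx mxE eqxx.
Qed.

Lemma effective_resistanceE i j :
  effective_resistance e i j = mxform Q (potential i j) (potential i j).
Proof.
rewrite /mxform potential_laplacian /effective_resistance /potential.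
by rewrite -dipole_tr trmxK trmx_mul trmxK mulmxA.
Qed.

End Laplacian.

(** * The Jacobian at a state with one consensus link *)

Section OneConsensusLink.
Variables (R : realType) (N : nat) (e : rel 'I_N).
Hypotheses (e_sym : symmetric e) (e_irr : irreflexive e).
Variables (r : R) (x : 'rV[R]_N) (i j : 'I_N).
Hypotheses (r_gt0 : 0 < r) (x_db : detailed_balance e r x).
Hypotheses (ij_link : e i j).
Hypothesis (ij_only : consensus_links e x = [set [set i; j]]%SET).

Lemma consensus_linkE k l : e k l ->
  (x 0 k - x 0 l == 0) = (k == i) && (l == j) || (k == j) && (l == i).
Proof.
move=> kl.
have kl_neq : k != l by apply: contraTneq kl => ->; rewrite e_irr.
have xij : x 0 i - x 0 j == 0.
  have : [set i; j]%SET \in consensus_links e x by rewrite ij_only inE.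
  case/imsetP => -[a b]; rewrite inE /= => /andP[_ ab] E.
  have : i \in [set a; b]%SET by rewrite -E !inE eqxx.
  have : j \in [set a; b]%SET by rewrite -E !inE eqxx orbT.
  rewrite !inE => /orP[]/eqP-> /orP[]/eqP->; rewrite ?subrr //.
  by rewrite -oppr_eq0 opprB.
apply/idP/idP => [xkl|/orP[]/andP[/eqP-> /eqP-> //]]; last first.
  by rewrite -oppr_eq0 opprB.
have : [set k; l]%SET \in consensus_links e x.
  by apply/imsetP; exists (k, l) => //; rewrite inE /= kl.
rewrite ij_only inE => /eqP E.
have : k \in [set i; j]%SET by rewrite -E !inE eqxx.
have : l \in [set i; j]%SET by rewrite -E !inE eqxx orbT.
rewrite !inE => /orP[]/eqP El /orP[]/eqP Ek; move: kl_neq;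
  by rewrite El Ek ?eqxx ?orbT.
Qed.

Lemma link_weight k l : e k l ->
  r - 3 * (x 0 k - x 0 l) ^+ 2 =
    - 2 * r + 3 * r * ((k == i) && (l == j) || (k == j) && (l == i))%:R.
Proof.
move=> kl; rewrite -consensus_linkE //.
have [->|d0] := eqVneq (x 0 k - x 0 l) 0; first by rewrite mulr1n; ring.
have := x_db kl; rewrite !inE (negPf d0) /= => /orP[] /eqP->;
  by rewrite ?sqrrN sqr_sqrtr ?ltW //= mulr0n; ring.
Qed.

Lemma Jac_decomposition :
  Jac e r x = (- 2 * r) *: laplacian e
              + (3 * r) *: ((dipole i j)^T *m dipole i j).
Proof.
have ij : i != j by apply: contraTneq ij_link => ->; rewrite e_irr.
apply: trmx_inj; rewrite linearD !linearZ /= laplacian_tr // trmx_mul.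
rewrite (trmxK (dipole i j)).
(* Both sides are compared through their action on an arbitrary row h. *)
apply/row_matrixP => a; rewrite !rowE; move: (delta_mx 0 a) => h.
rewrite mul_Jac_tr mulmxDr -!scalemxAr mul_laplacian // mulmxA mul_dipole_tr.
rewrite mul_scalar_mx; apply/rowP => k; rewrite !mxE eqxx /=.
under eq_bigr => l kl do rewrite link_weight // mulrDl -!mulrA.
rewrite big_split /= -!mulr_sumr; congr (_ + _).
  by rewrite mulrA.
rewrite -mulrA; congr (_ * (_ * _)).
have [->|ki] := eqVneq k i.
  rewrite (negPf ij) /= subr0 mulr1 (bigD1 j) //= eqxx mul1r big1 ?addr0 //.
  by move=> l /andP[_ /negPf->]; rewrite mul0r.
have [->|kj] := eqVneq k j.
  rewrite /= sub0r mulrN1 opprB (bigD1 i) /=; last by rewrite e_sym.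
  by rewrite eqxx mul1r big1 ?addr0 // => l /andP[_ /negPf->]; rewrite mul0r.
by rewrite subrr mulr0 big1 // => l _; rewrite mul0r.
Qed.

Lemma Jac_tr : (Jac e r x)^T = Jac e r x.
Proof.
rewrite Jac_decomposition linearD !linearZ /= laplacian_tr // trmx_mul.
by rewrite (trmxK (dipole i j)).
Qed.

Lemma Jac_form v :
  mxform (Jac e r x) v v =
    - 2 * r * mxform (laplacian e) v v + 3 * r * (v 0 i - v 0 j) ^+ 2.
Proof.
rewrite Jac_decomposition /mxform mulmxDr mulmxDl -!scalemxAr -!scalemxAl.
rewrite mxE [X in X + _]mxE [X in _ + X]mxE; congr (_ + _ * _).
have -> : v *m ((dipole i j)^T *m dipole i j) *m v^T =
          (v *m (dipole i j)^T) *m (v *m (dipole i j)^T)^T.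
  by rewrite (trmx_mul v) (trmxK (dipole i j)) !mulmxA.
by rewrite mul_dipole_tr tr_scalar_mx -scalar_mxM mxE eqxx expr2.
Qed.

End OneConsensusLink.

Theorem theorem1 (R : realType) (N : nat) (e : rel 'I_N)
    (e_sym : symmetric e) (e_irr : irreflexive e) (e_conn : connected_graph e)
    (r : R) (r_gt0 : 0 < r) (x : 'rV[R]_N) (x_mixed : mixed_stationary e r x)
    (i j : 'I_N) (ij_link : e i j)
    (ij_only : consensus_links e x = [set [set i; j]]%SET) :
  (effective_resistance e i j < 2 / 3 :> R -> stable e r x) /\
  (2 / 3 < effective_resistance e i j :> R -> unstable e r x).
Proof.
have [x_db _ _] := x_mixed; rewrite effective_resistanceE //.
have JacE := Jac_form e_sym e_irr r_gt0 x_db ij_link ij_only.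
have pot := mxform_potential e_sym e_irr e_conn i j.
have psdQ := laplacian_psd (R := R) e_sym e_irr.
set w := potential e i j in pot *; set omega := mxform _ w w.
split=> omega_bound.
  move=> c /(congr1 trmx); rewrite trmx_mul trmxK trmx0 -[c]trmxK.
  move: c^T => v; rewrite trmxK trmx_eq0 => v_orth v0.
  rewrite -/(mxform _ _ _) JacE.
  have Qv_gt0 : 0 < mxform (laplacian e) v v.
    rewrite lt_def psdQ andbT; apply: contra_neq v0 => Qv0.
    exact: (laplacian_ker_orth e_sym e_irr e_conn Qv0).
  have := psd_cauchy_schwarz w v (laplacian_tr e_sym) psdQ.
  rewrite pot -/omega; have := mulr_gt0 r_gt0 Qv_gt0.
  move: (mxform (laplacian e) v v) Qv_gt0 ((_ - _) ^+ 2) => q q0 d rq dq; nra.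
have omega_gt0 : 0 < omega by apply: lt_trans omega_bound; lra.
apply: (@mxform_pos_eigenvalue _ _ _ w).
  exact: (Jac_tr e_sym e_irr r_gt0 x_db ij_link ij_only).
rewrite JacE -pot -/omega.
rewrite (_ : _ + _ = r * omega * (3 * omega - 2)); last by ring.
by rewrite !mulr_gt0 //; lra.
Qed.
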